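(* For a composition $\alpha$, write $\omega\rho(\psi_\alpha)=\sum_\beta c_\beta\psi_\beta$. Then for every composition $\beta$, $c_\beta=(-1)^{|\beta|-l(\beta)}\,\mathrm{MaxOne}^{\otimes l(\beta)}\Delta_\beta(\psi_\alpha)$.
   Context: $\mathrm{QSym}$ is the algebra of quasisymmetric functions over $\mathbb{C}$, with monomial basis $M_\alpha=\sum_{i_1<\dots<i_k}x_{i_1}^{\alpha_1}\cdots x_{i_k}^{\alpha_k}$ and fundamental basis $L_\alpha=\sum_{\beta\text{ refines }\alpha}M_\beta$. For a composition $\alpha$ of $n$ let $D(\alpha)=\{\alpha_1,\alpha_1+\alpha_2,\dots,\alpha_1+\cdots+\alpha_{l-1}\}\subseteq[n-1]$ and let $\alpha^c$ be the composition with $D(\alpha^c)=[n-1]\setminus D(\alpha)$. $\omega\rho$ is the linear automorphism with $\omega\rho(L_\alpha)=L_{\alpha^c}$. Let $\pi(\alpha)=\prod_{i=1}^{l}(\alpha_1+\cdots+\alpha_i)$; if $\alpha$ refines $\beta$, let $\alpha^{(i)}$ be the parts of $\alpha$ summing to $\beta_i$ and $\pi(\alpha,\beta)=\prod_i\pi(\alpha^{(i)})$. Define $\psi_\alpha=\sum_{\beta\text{ coarsens }\alpha}\frac{1}{\pi(\alpha,\beta)}M_\beta$. $\mathrm{MaxOne}$ is the linear functional with $\mathrm{MaxOne}(L_\alpha)=(-1)^k$ if $\alpha=(n-k,1^k)$ for some $0\le k<n$ and $0$ otherwise. The coproduct is $\Delta(M_\alpha)=\sum_{\beta\cdot\gamma=\alpha}M_\beta\otimes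 M_\gamma$ (deconcatenation, $M_\varnothing=1$), and for a composition $\gamma$ of length $l$, $\Delta_\gamma$ is the $(l-1)$-fold iterated coproduct followed by projection onto $\mathrm{QSym}_{\gamma_1}\otimes\cdots\otimes\mathrm{QSym}_{\gamma_l}$. *)

(* Defs.v *)
From HB Require Import structures.
From mathcomp Require Import all_boot all_order all_algebra.
From mathcomp Require Import finmap monalg complex.
From mathcomp Require Import boolp reals functions.

Set Implicit Arguments.
Unset Strict Implicit.
Unset Printing Implicit Defensive.

Import Order.TTheory GRing.Theory Num.Theory.

Local Open Scope ring_scope.

(** The size |a| is [sumn a] and the length l(a) is [size a]; the empty
    composition is allowed. *)
Record composition := Composition { parts :> seq nat; comp_gt0 : all (ltn 0) parts }.

HB.instance Definition _ := [isSub for parts].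
HB.instance Definition _ := [Countable of composition by <:].

Lemma comp_take_subproof k (a : composition) : all (ltn 0) (take k a).
Proof. by apply/allP => x /mem_take; apply/allP/(comp_gt0 a). Qed.

Lemma comp_drop_subproof k (a : composition) : all (ltn 0) (drop k a).
Proof. by apply/allP => x /mem_drop; apply/allP/(comp_gt0 a). Qed.

Definition ctake k (a : composition) := Composition (comp_take_subproof k a).
Definition cdrop k (a : composition) := Composition (comp_drop_subproof k a).

Fixpoint comps_seq (n : nat) : seq (seq nat) :=
  if n is m.+1 then
    [seq 1%N :: s | s <- comps_seq m] ++
    [seq (head 0%N s).+1 :: behead s | s <- comps_seq m & s != [::]]
  else [:: [::]].

(** All compositions of [n], without repetition. *)
Definition comps (n : nat) : seq composition := pmap insub (comps_seq n).

Lemma mem_comps_seq n s : (s \in comps_seq n) = all (ltn 0) s && (sumn s == n).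
Proof.
elim: n s => [|n IH] s; first by rewrite inE; case: s => [|[|x] s] //=; rewrite addn_eq0 andbF.
rewrite /= mem_cat; apply/orP/andP => [[]|].
- case/mapP => t; rewrite IH => /andP[pt /eqP st] ->.
  by rewrite /= pt st.
- case/mapP => t; rewrite mem_filter IH; case: t => [//|x t] /= /andP[/andP[x0 pt] st].
  by move=> ->; rewrite /= pt.
- case: s => [[]//|[|[|x]] s] /= [] //.
  + move=> ps st; left; apply/mapP; exists s => //; rewrite IH ps.
    by move: st; rewrite add1n eqSS.
  + move=> ps st; right; apply/mapP; exists (x.+1 :: s) => //.
    by rewrite mem_filter IH /= ps.
Qed.

Lemma mem_comps n (a : composition) : (a \in comps n) = (sumn a == n).
Proof.
rewrite /comps mem_pmap_sub mem_comps_seq /=.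
by case: a => s /= ->.
Qed.

Lemma comps_uniq n : uniq (comps n).
Proof.
apply: pmap_sub_uniq; elim: n => [//|n IH] /=.
rewrite cat_uniq map_inj_uniq ?IH /=; last by move=> s t [].
apply/andP; split.
  apply/hasPn => s /mapP[t]; rewrite mem_filter mem_comps_seq.
  case: t => // x t /= /andP[/andP[x0 _] _] ->.
  by apply/negP => /mapP[u _] [e _]; rewrite e in x0.
rewrite map_inj_in_uniq ?filter_uniq // => s t.
by rewrite !mem_filter; case: s => // x s; case: t => // y t _ _ /= [-> ->].
Qed.

(** The set D(a), listed increasingly. *)
Definition descents (a : seq nat) : seq nat :=
  take (size a).-1 (scanl addn 0%N a).

(** The elements of [n-1] outside D(a), for n = |a|. *)
Definition codescents (a : seq nat) : seq nat :=
  [seq i <- iota 1 (sumn a).-1 | i \notin descents a].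

(** a^c: the successive differences of 0 < codescents < n. *)
Definition compl_seq (a : seq nat) : seq nat :=
  if sumn a == 0%N then [::]
  else pairmap (fun x y => (y - x)%N) 0%N (rcons (codescents a) (sumn a)).

Lemma codescents_path a : sumn a != 0%N ->
  path ltn 0%N (rcons (codescents a) (sumn a)).
Proof.
move=> n0; rewrite rcons_path; apply/andP; split.
  rewrite path_sortedE; last exact: ltn_trans.
  apply/andP; split.
    by apply/allP => i; rewrite mem_filter mem_iota => /and3P[].
  by apply: sorted_filter; [exact: ltn_trans|exact: iota_ltn_sorted].
case/lastP E: (codescents a) => [|s x]; first by rewrite /= lt0n.
have: x \in codescents a by rewrite E mem_rcons mem_head.
rewrite last_rcons mem_filter mem_iota add1n prednK ?lt0n //.
by case/and3P.
Qed.

Lemma pairmap_sub_gt0 x s : path ltn x s ->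
  all (ltn 0) (pairmap (fun x y => (y - x)%N) x s).
Proof. by elim: s x => //= y s IH x /andP[xy /IH ->]; rewrite subn_gt0 xy. Qed.

Lemma scanl_pairmap_sub x s : path ltn x s ->
  scanl addn x (pairmap (fun x y => (y - x)%N) x s) = s.
Proof.
elim: s x => //= y s IH x /andP[xy ps].
by rewrite subnKC ?(ltnW xy) // IH.
Qed.

Lemma compl_subproof (a : composition) : all (ltn 0) (compl_seq a).
Proof.
rewrite /compl_seq; case: ifPn => // n0.
exact/pairmap_sub_gt0/codescents_path.
Qed.

Definition compl (a : composition) : composition := Composition (compl_subproof a).

Lemma last_scanl_addn x s : last x (scanl addn x s) = (x + sumn s)%N.
Proof. by elim: s x => [|y s IH] x /=; rewrite ?addn0 // IH addnA. Qed.

Lemma sumn_compl (a : composition) : sumn (compl a) = sumn a.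
Proof.
rewrite /= /compl_seq; case: ifPn => [/eqP-> //|n0].
rewrite -[LHS]add0n -last_scanl_addn scanl_pairmap_sub ?codescents_path //.
by rewrite last_rcons.
Qed.

Lemma descents_compl (a : composition) : descents (compl a) = codescents a.
Proof.
rewrite /descents /= /compl_seq; case: ifPn => [/eqP n0|n0].
  by rewrite /codescents n0.
rewrite scanl_pairmap_sub ?codescents_path // size_pairmap size_rcons /=.
by rewrite -cats1 take_size_cat.
Qed.

Lemma scanl_addn_cat x s t :
  scanl addn x (s ++ t) = scanl addn x s ++ scanl addn (x + sumn s)%N t.
Proof. by elim: s x => [|y s IH] x /=; rewrite ?addn0 // IH addnA. Qed.

Lemma rcons_descents (a : seq nat) : a != [::] ->
  rcons (descents a) (sumn a) = scanl addn 0%N a.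
Proof.
case/lastP: a => [//|a x] _.
rewrite /descents size_rcons -!cats1 scanl_addn_cat /= take_size_cat ?size_scanl //.
by rewrite sumn_cat /= addn0.
Qed.

Lemma scanl_addn_path x s : all (ltn 0) s -> path ltn x (scanl addn x s).
Proof.
elim: s x => //= y s IH x /andP[y0 /IH ->].
by rewrite -{1}[x]addn0 ltn_add2l y0.
Qed.

Lemma pairmap_sub_scanl x s :
  pairmap (fun x y => (y - x)%N) x (scanl addn x s) = s.
Proof. by elim: s x => //= y s IH x; rewrite addKn IH. Qed.

Lemma complK : involutive compl.
Proof.
move=> a; apply/val_inj => /=.
have [a0|a0] := eqVneq (parts a) [::].
  by rewrite /compl_seq /= (sumn_compl a) a0.
have n0 : sumn a != 0%N.
  by case: a a0 => [[|[|x] s]] //= p _; rewrite addn_eq0.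
have p := scanl_addn_path 0 (comp_gt0 a).
rewrite -rcons_descents // path_sortedE in p; last exact: ltn_trans.
case/andP: p; rewrite all_rcons => /andP[_ pD].
rewrite (sorted_pairwise ltn_trans) pairwise_rcons -(sorted_pairwise ltn_trans).
case/andP => ltD sD.
rewrite {1}/compl_seq -[compl_seq a]/(parts (compl a)) sumn_compl (negPf n0).
rewrite -[RHS](pairmap_sub_scanl 0) -rcons_descents //.
congr (pairmap _ _ (rcons _ _)); rewrite /codescents descents_compl sumn_compl.
apply: (irr_sorted_eq ltn_trans ltnn) => //.
  by apply: sorted_filter; [exact: ltn_trans|exact: iota_ltn_sorted].
move=> i; rewrite !mem_filter negb_and negbK mem_iota add1n prednK ?lt0n //.
case: (boolP (i \in descents a)) => iD; last by rewrite orFb andNb.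
by rewrite /= (allP ltD) // andbT -lt0n; apply: (allP pD).
Qed.

(** Cuts [a] from the left into blocks a^(1), ..., a^(l), the i-th one being
    the shortest piece whose sum reaches b_i. *)
Fixpoint blocks (a b : seq nat) : seq (seq nat) :=
  if b is n :: b' then
    let k := (find (leq n) (scanl addn 0%N a)).+1 in
    take k a :: blocks (drop k a) b'
  else [::].

(** [a] refines [b], i.e. [b] coarsens [a]. *)
Definition refines (a b : seq nat) : bool :=
  (flatten (blocks a b) == a) && (map sumn (blocks a b) == b).

Lemma find_scanl_cat x s t : s != [::] -> all (ltn 0) s ->
  (find (leq (x + sumn s)) (scanl addn x (s ++ t))).+1 = size s.
Proof.
elim: s x => // y s IH x _ /= /andP[y0 ps].
case: s IH ps => [|z s] IH ps; first by rewrite /= addn0 leqnn.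
case: leqP => [|_]; last by rewrite addnA IH.
rewrite leq_add2l -{2}[y]addn0 leq_add2l leqn0 /=.
by move: ps => /= /andP[]; rewrite lt0n addn_eq0 => /negPf->.
Qed.

Lemma blocks_flatten ss : all (all (ltn 0)) ss -> all (predC (@nilp nat)) ss ->
  blocks (flatten ss) (map sumn ss) = ss.
Proof.
elim: ss => // s ss IH /= /andP[ps pss] /andP[s0 ss0].
rewrite -[sumn s]add0n find_scanl_cat //; last by case: s s0 ps.
by rewrite take_size_cat // drop_size_cat // IH.
Qed.

Lemma refinesP (a b : composition) :
  reflect (exists2 ss, flatten ss = a & map sumn ss = b) (refines a b).
Proof.
apply: (iffP andP) => [[/eqP fa /eqP sb]|[ss fa sb]].
  by exists (blocks a b).
rewrite -fa -sb blocks_flatten ?eqxx //; last first.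
  apply/allP => s sin; have: sumn s \in parts b by rewrite -sb map_f.
  by move/(allP (comp_gt0 b)); case: s {sin}.
apply/allP => s sin; apply/allP => x xs; apply: (allP (comp_gt0 a)).
by rewrite -fa; apply/flattenP; exists s.
Qed.

Lemma refines_refl (a : composition) : refines a a.
Proof.
apply/refinesP; exists [seq [:: x] | x <- a]; first exact: flatten_seq1.
by rewrite -map_comp -[RHS]map_id; apply: eq_map => x /=; rewrite addn0.
Qed.

Lemma refines_sumn (a b : composition) : refines a b -> sumn a = sumn b.
Proof.
case/refinesP => ss <- <-; elim: ss => //= s ss IH.
by rewrite sumn_cat IH.
Qed.

Lemma refines_size (a b : composition) : refines a b -> a != b -> (size b < size a)%N.
Proof.
case/refinesP => ss fa sb neq.
have ss0 : all (predC (@nilp nat)) ss.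
  apply/allP => s sin; have: sumn s \in parts b by rewrite -sb map_f.
  by move/(allP (comp_gt0 b)); case: s {sin}.
have {neq} : flatten ss != map sumn ss by rewrite fa sb.
rewrite -fa -sb size_map {fa sb a b}; elim: ss ss0 => //= s ss IH /andP[s0 ss0].
rewrite size_cat; case: s s0 => [//|x [|y s]] _ neq.
  by rewrite /= add1n ltnS IH //; apply: contraNneq neq => ->; rewrite /= addn0.
rewrite /= addSn ltnS addSn ltnS (leq_trans _ (leq_addl _ _)) //.
by elim: ss ss0 {IH neq} => //= t ss IH /andP[t0 /IH]; rewrite size_cat; case: t t0 => //= z t _ l;
  rewrite addSn ltnS (leq_trans l) ?leq_addl.
Qed.

(** pi(a) = [ppi a] and pi(a, b) = [ppi2 a b]. *)
Definition ppi (a : seq nat) : nat := (\prod_(s <- scanl addn 0 a) s)%N.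
Definition ppi2 (a b : seq nat) : nat := (\prod_(t <- blocks a b) ppi t)%N.

(** The monomial x_{i_1}^{a_1} ... x_{i_k}^{a_k}. *)
Definition monom (i a : seq nat) : {cmonom nat} :=
  \big[mmul/mone]_(p <- zip i a) expcmn (ucm p.1) p.2.

(** i_1 < ... < i_k, where k is the length of [a]. *)
Definition indices (a i : seq nat) : bool := sorted ltn i && (size i == size a).

Lemma expcmnE (m : {cmonom nat}) n j : expcmn m n j = (n * m j)%N.
Proof.
have E : expcmn m n = iter n (mulcm m) (onecm nat).
  by case: n => // n; rewrite /expcmn iteropS iterSr mulcm0.
rewrite E; elim: n {E} => [|n IH] /=; first by rewrite onecmE.
by rewrite mulcmE IH mulSn.
Qed.

Lemma monomE i a j : monom i a j = (\sum_(p <- zip i a | p.1 == j) p.2)%N.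
Proof.
rewrite /monom big_mkcond /=; elim: (zip i a) => [|p s IH].
  by rewrite !big_nil cm1.
rewrite !big_cons cmM IH expcmnE ucmE; case: eqP => _; by rewrite ?muln1 ?muln0.
Qed.

Lemma mdeg_monom i a : size i = size a -> mdeg (monom i a) = sumn a.
Proof.
rewrite /monom; elim: i a => [|x i IH] [|y a] //=.
  by rewrite big_nil mdeg1.
case=> s; rewrite big_cons mdegM IH //=; congr addn.
rewrite (@mdegEw _ _ [fset x]%fset).
  by rewrite big_seq_fset1 expcmnE ucmE eqxx muln1.
apply/fsubsetP => j; rewrite -cmE_neq0 expcmnE ucmE inE (eq_sym j x).
by case: (x == j); rewrite //= muln0.
Qed.

Lemma monom_nth i a k : indices a i -> (k < size a)%N ->
  monom i a (nth 0%N i k) = nth 0%N a k.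
Proof.
case/andP => si /eqP ss ka; rewrite monomE.
have ui : uniq i by apply: sorted_uniq si => //; [exact: ltn_trans|exact: ltnn].
have {}si : True by [].
elim: i a k ss ka ui => [|x i IH] [|y a] //= k [ss] ka /andP[xi ui].
case: k ka => [|k] ka /=; rewrite big_cons /=.
  rewrite eqxx big_seq_cond big1 ?addn0 // => -[u v] /= /andP[uv /eqP e].
  case/negP: xi; rewrite -e -(@unzip1_zip _ _ i a) ?ss //.
  by apply/mapP; exists (u, v).
case: eqP => [e|_]; last exact: IH.
by case/negP: xi; rewrite e mem_nth // ss.
Qed.

Lemma monom_supp (a : composition) i j : indices a i -> (monom i a j != 0%N) = (j \in i).
Proof.
move=> ia; have /andP[_ /eqP ss] := ia; apply/idP/idP.
  apply: contraR => ji; rewrite monomE big_seq_cond big1 // => -[u v] /=.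
  case/andP => uv /eqP e; case/negP: ji; rewrite -e -(@unzip1_zip _ _ i a) ?ss //.
  by apply/mapP; exists (u, v).
move=> ji; rewrite -(nth_index 0%N ji) monom_nth -?ss ?index_mem //.
by rewrite -lt0n; apply: (allP (comp_gt0 a)); rewrite mem_nth // -ss index_mem.
Qed.

Lemma monom_inj (a b : composition) i j : indices a i -> indices b j ->
  monom i a = monom j b -> a = b.
Proof.
move=> ia jb e; have eij : i = j.
  have /andP[si _] := ia; have /andP[sj _] := jb.
  apply: (irr_sorted_eq ltn_trans ltnn si sj) => x.
  by rewrite -(monom_supp _ ia) -(monom_supp _ jb) e.
rewrite {}eij in ia e; have /andP[_ /eqP s1] := ia; have /andP[_ /eqP s2] := jb.
apply/val_inj/(@eq_from_nth _ 0%N) => [|k ka]; first by rewrite -s1 -s2.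
by rewrite /= -(monom_nth ia) // e (monom_nth jb) // -s2 s1.
Qed.

Lemma monom_surj (m : {cmonom nat}) :
  exists (a : composition) (i : seq nat), indices a i /\ m = monom i a.
Proof.
pose i := sort leq (finsupp m).
have ui : uniq i by rewrite sort_uniq fset_uniq.
have pa : all (ltn 0) (map m i).
  by apply/allP => _ /mapP[x xi ->]; rewrite /= lt0n cmE_neq0 -(mem_sort leq).
exists (Composition pa), i.
have ia : indices (Composition pa) i.
  by rewrite /indices /= size_map eqxx andbT ltn_sorted_uniq_leq ui sort_sorted.
split=> //; apply/eqP/cmP => x; case: (boolP (x \in i)) => xi.
  rewrite -(nth_index 0%N xi) monom_nth //= ?size_map ?index_mem //.
  by rewrite (nth_map 0%N) ?index_mem // nth_index.
have := monom_supp x ia; rewrite (negPf xi) => /negbFE/eqP ->.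
by apply/eqP; rewrite cmE_eq0 -(mem_sort leq).
Qed.

Section QSym.
Variable K : numFieldType.

Definition quasisymmetric (f : {cmonom nat} -> K^o) : Prop :=
  (exists d, forall m, (d < mdeg m)%N -> f m = 0) /\
  (forall (a : composition) i j, indices a i -> indices a j ->
     f (monom i a) = f (monom j a)).

Definition qsym_pred : {pred {cmonom nat} -> K^o} :=
  fun f => `[< quasisymmetric f >].

Lemma qsym_submod_closed : submod_closed qsym_pred.
Proof.
split=> [|c f g /asboolP[[d fd] fq] /asboolP[[e ge] gq]]; apply/asboolP.
  by split=> //; exists 0%N.
split=> [|a i j ia ja]; last first.
  by rewrite !fctE (fq a i j) // (gq a i j).
exists (maxn d e) => m; rewrite gtn_max => /andP[dm em].
by rewrite !fctE fd // ge // scaler0 addr0.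
Qed.

HB.instance Definition _ :=
  GRing.isSubmodClosed.Build K ({cmonom nat} -> K^o) qsym_pred qsym_submod_closed.

Record QSym := MkQSym {
  series :> {cmonom nat} -> K^o;
  seriesP : series \in qsym_pred }.

HB.instance Definition _ := [isSub for series].
HB.instance Definition _ := [Choice of QSym by <:].
HB.instance Definition _ := [SubChoice_isSubLmodule of QSym by <:].

Lemma qsymP (f g : QSym) : series f =1 series g <-> f = g.
Proof. by split=> [fg|-> //]; apply/val_inj/funext. Qed.

(** The coefficient of x^m in M_a is 1 if m = x_{i_1}^{a_1} ... x_{i_k}^{a_k} for
    some (necessarily unique) i_1 < ... < i_k, and 0 otherwise. *)
Definition M_series (a : composition) : {cmonom nat} -> K^o :=
  fun m => (`[< exists i, indices a i /\ m = monom i a >])%:R.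

Lemma M_seriesE (a b : composition) i : indices b i ->
  M_series a (monom i b) = (a == b)%:R.
Proof.
move=> ib; rewrite /M_series; congr (_%:R); congr nat_of_bool.
apply/asboolP/eqP => [[j [ja e]]|->]; last by exists i.
by rewrite (monom_inj ib ja e).
Qed.

Lemma M_qsym (a : composition) : M_series a \in qsym_pred.
Proof.
apply/asboolP; split=> [|b i j ib jb]; last by rewrite !M_seriesE.
exists (sumn a) => m; have [b [i [ib ->]]] := monom_surj m.
have /andP[_ /eqP si] := ib; rewrite M_seriesE // mdeg_monom //.
by case: eqP => // ->; rewrite ltnn.
Qed.

Definition M (a : composition) : QSym := MkQSym (M_qsym a).

Lemma indices_iota (a : composition) : indices a (iota 0 (size a)).
Proof. by rewrite /indices iota_ltn_sorted size_iota eqxx. Qed.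

Definition Mcoef (f : QSym) (a : composition) : K := f (monom (iota 0 (size a)) a).

Arguments Mcoef : simpl never.

Lemma Mcoef_linear c f g a : Mcoef (c *: f + g) a = c * Mcoef f a + Mcoef g a.
Proof. by []. Qed.

Lemma seriesE (f : QSym) (a : composition) i : indices a i ->
  f (monom i a) = Mcoef f a.
Proof.
move=> ia; have /asboolP[_ fq] := seriesP f.
exact: fq ia (indices_iota a).
Qed.

Lemma Mcoef_M a b : Mcoef (M a) b = (a == b)%:R.
Proof. by rewrite /Mcoef /= M_seriesE // indices_iota. Qed.

Definition comps_le (d : nat) : seq composition := flatten [seq comps n | n <- iota 0 d].

Lemma mem_comps_le d a : (a \in comps_le d) = (sumn a < d)%N.
Proof.
apply/flattenP/idP => [[s /mapP[n]]|ad].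
  by rewrite mem_iota add0n => /andP[_ nd] ->; rewrite mem_comps => /eqP ->.
exists (comps (sumn a)); last by rewrite mem_comps.
by apply: map_f; rewrite mem_iota.
Qed.

Lemma comps_le_uniq d : uniq (comps_le d).
Proof.
elim: d => // d IH; rewrite /comps_le -addn1 iotaD map_cat flatten_cat /= cats0.
rewrite cat_uniq IH comps_uniq andbT; apply/hasPn => a; rewrite mem_comps => /eqP sa.
by rewrite -/(comps_le d) /= mem_comps_le sa add0n ltnn.
Qed.

Definition qbound (f : QSym) (d : nat) :=
  forall a : composition, (d <= sumn a)%N -> Mcoef f a = 0.

Lemma qboundP f : exists d, qbound f d.
Proof.
have /asboolP[[d fd] _] := seriesP f; exists d.+1 => a da; apply: fd.
by rewrite mdeg_monom // size_iota.
Qed.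

Lemma M_expansion f d : qbound f d ->
  f = \sum_(a <- comps_le d) Mcoef f a *: M a.
Proof.
move=> fd; apply/qsymP => m; have [b [i [ib ->]]] := monom_surj m.
rewrite seriesE // seriesE //.
have -> : Mcoef (\sum_(a <- comps_le d) Mcoef f a *: M a) b =
          \sum_(a <- comps_le d) Mcoef f a * (a == b)%:R.
  elim: (comps_le d) => [|a s IH]; first by rewrite !big_nil.
  by rewrite !big_cons -IH -Mcoef_M.
case: (ltnP (sumn b) d) => bd; last first.
  rewrite fd // big_seq big1 // => a; rewrite mem_comps_le => ad.
  case: eqP => [ab|_]; last by rewrite mulr0.
  by rewrite -ab leqNgt ad in bd.
rewrite (bigD1_seq b) ?mem_comps_le ?comps_le_uniq //= eqxx mulr1.
by rewrite big1 ?addr0 // => a /negPf ->; rewrite mulr0.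
Qed.

Lemma comps_le_sum (V : lmodType K) (phi : composition -> V) f d e :
  qbound f d -> qbound f e ->
  \sum_(a <- comps_le d) Mcoef f a *: phi a = \sum_(a <- comps_le e) Mcoef f a *: phi a.
Proof.
wlog de : d e / (d <= e)%N.
  by move=> H fd fe; case/orP: (leq_total d e) => de; [|symmetry]; apply: H.
move=> fd _; rewrite /comps_le -(subnKC de) iotaD map_cat flatten_cat big_cat /=.
rewrite [X in _ = _ + X]big_seq [X in _ = _ + X]big1 ?addr0 // => a /flattenP[s /mapP[n]].
rewrite mem_iota add0n => /andP[dn _] ->; rewrite mem_comps => /eqP e'.
by rewrite fd ?scale0r // e'.
Qed.

Lemma M_ext (V : lmodType K) (phi : composition -> V) :
  exists f : {linear QSym -> V}, forall a, f (M a) = phi a.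
Proof.
pose F f := \sum_(a <- comps_le (projT1 (cid (qboundP f)))) Mcoef f a *: phi a.
have FE f d : qbound f d -> F f = \sum_(a <- comps_le d) Mcoef f a *: phi a.
  by move=> fd; rewrite /F; case: cid => e fe /=; apply: comps_le_sum.
have Flin : linear F.
  move=> c f g; have [d fd] := qboundP f; have [e ge] := qboundP g.
  pose n := maxn d e.
  have fn : qbound f n by move=> a na; rewrite fd // (leq_trans (leq_maxl d e)).
  have gn : qbound g n by move=> a na; rewrite ge // (leq_trans (leq_maxr d e)).
  rewrite (FE f n) // (FE g n) // (FE _ n) => [|a na]; last first.
    by rewrite Mcoef_linear fn // gn // mulr0 addr0.
  rewrite scaler_sumr -big_split /=; apply: eq_bigr => a _.
  by rewrite Mcoef_linear scalerDl scalerA.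
pose FL := HB.pack_for {linear QSym -> V} F (GRing.isLinear.Build _ _ _ _ F Flin).
exists FL => a; rewrite /= (FE _ (sumn a).+1) => [|b ab]; last first.
  by rewrite Mcoef_M; case: eqP => // e; rewrite e ltnn in ab.
rewrite (bigD1_seq a) ?mem_comps_le ?comps_le_uniq //= Mcoef_M eqxx scale1r.
by rewrite big1 ?addr0 // => b ba; rewrite Mcoef_M eq_sym (negPf ba) scale0r.
Qed.

(** The linear map taking prescribed values on the basis (M_a). *)
Definition Mlin (V : lmodType K) (phi : composition -> V) : {linear QSym -> V} :=
  projT1 (cid (M_ext phi)).

Lemma MlinE (V : lmodType K) (phi : composition -> V) a : Mlin phi (M a) = phi a.
Proof. exact: (projT2 (cid (M_ext phi))). Qed.

Lemma Mlin_uniq (V : lmodType K) (f g : {linear QSym -> V}) :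
  (forall a, f (M a) = g (M a)) -> f =1 g.
Proof.
move=> fg h; have [d hd] := qboundP h; rewrite (M_expansion hd) !linear_sum.
by apply: eq_bigr => a _; rewrite !linearZ /= fg.
Qed.

Definition L (a : composition) : QSym := \sum_(b <- comps (sumn a) | refines b a) M b.

Definition psi (a : composition) : QSym :=
  \sum_(b <- comps (sumn a) | refines a b) (ppi2 a b)%:R^-1 *: M b.

(** Families that are triangular with respect to (M_a) are bases. *)
Section Triangular.
Variables (r : composition -> composition -> bool).
Variables (e : composition -> composition -> K) (mu : composition -> nat).
Hypothesis r_refl : forall a, r a a.
Hypothesis r_mu : forall a b : composition,
  sumn b = sumn a -> r a b -> b != a -> (mu b < mu a)%N.
Hypothesis e_neq0 : forall a, e a a != 0.

Definition tri_fam (a : composition) := \sum_(b <- comps (sumn a) | r a b) e a b *: M b.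

Lemma tri_famE a : tri_fam a =
  e a a *: M a + \sum_(b <- comps (sumn a) | r a b && (b != a)) e a b *: M b.
Proof.
rewrite /tri_fam -big_filter (bigD1_seq a) ?filter_uniq ?comps_uniq //=.
  by rewrite big_filter_cond.
by rewrite mem_filter r_refl mem_comps /=.
Qed.

Lemma tri_ext (V : lmodType K) (phi : composition -> V) :
  exists f : {linear QSym -> V}, forall a, f (tri_fam a) = phi a.
Proof.
pose step g a := (e a a)^-1 *:
  (phi a - \sum_(b <- comps (sumn a) | r a b && (b != a)) e a b *: g b).
pose val := fun n => iter n step (fun=> 0).
have valE n a : (mu a < n)%N -> val n a = val (mu a).+1 a.
  have [k] := ubnP (mu a); elim: k a n => // k IH a [//|n] ak an.
  rewrite /val 2!iterS {1 3}/step; congr (_ *: (_ - _)).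
  rewrite big_seq_cond [RHS]big_seq_cond; apply: eq_bigr => b /andP[].
  rewrite mem_comps => /eqP sb /andP[rb ba]; have ba' := r_mu sb rb ba.
  have bk : (mu b < k)%N := leq_trans ba' ak.
  congr (_ *: _); exact: etrans (IH b n bk (leq_trans ba' an)) (esym (IH b _ bk ba')).
have [f fE] := M_ext (fun a => val (mu a).+1 a); exists f => a.
have {}fE b : f (M b) = step (val (mu b)) b := fE b.
rewrite tri_famE linearD linearZZ fE linear_sum /step.
rewrite scalerA divff // scale1r -[RHS]addr0 -addrA; congr (_ + _).
apply/eqP; rewrite addrC subr_eq0; apply/eqP.
rewrite big_seq_cond [RHS]big_seq_cond; apply: eq_bigr => b /andP[].
rewrite mem_comps => /eqP sb /andP[rb ba]; have ba' := r_mu sb rb ba.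
by rewrite linearZZ fE valE.
Qed.

Lemma tri_uniq (V : lmodType K) (f g : {linear QSym -> V}) :
  (forall a, f (tri_fam a) = g (tri_fam a)) -> f =1 g.
Proof.
move=> fg; apply: Mlin_uniq => a; have [n] := ubnP (mu a).
elim: n a => // n IH a an; have := fg a.
rewrite tri_famE !linearD /= !linearZ /= !linear_sum /=.
rewrite [X in _ + X = _](_ : _ =
  \sum_(b <- comps (sumn a) | r a b && (b != a)) g (e a b *: M b)).
  by move/addIr/(scalerI (e_neq0 a)).
rewrite big_seq_cond [RHS]big_seq_cond; apply: eq_bigr => b /andP[].
rewrite mem_comps => /eqP sb /andP[rb ba]; have ba' := r_mu sb rb ba.
by rewrite !linearZ /= IH // (leq_trans ba' _) // -ltnS.
Qed.

End Triangular.

Lemma L_tri a : L a = tri_fam (fun a b => refines b a) (fun _ _ => 1) a.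
Proof. by apply: eq_bigr => b _; rewrite scale1r. Qed.

Lemma size_le_sumn (a : composition) : (size a <= sumn a)%N.
Proof.
case: a => s /=; elim: s => //= x s IH /andP[x0 /IH].
by rewrite -add1n => h; apply: leq_add.
Qed.

Lemma L_mu (a b : composition) : sumn b = sumn a -> refines b a -> b != a ->
  (sumn b - size b < sumn a - size a)%N.
Proof.
move=> e rb ba; have h := refines_size rb ba; rewrite e ltn_sub2l //.
by rewrite -e (leq_trans h) ?size_le_sumn.
Qed.

Lemma L_ext (V : lmodType K) (phi : composition -> V) :
  exists f : {linear QSym -> V}, forall a, f (L a) = phi a.
Proof.
have [f fE] := tri_ext (e := fun _ _ => 1) refines_refl L_mu (fun=> oner_neq0 K) phi.
by exists f => a; rewrite L_tri.
Qed.

(** The linear map taking prescribed values on the basis (L_a). *)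
Definition Llin (V : lmodType K) (phi : composition -> V) : {linear QSym -> V} :=
  projT1 (cid (L_ext phi)).

Lemma LlinE (V : lmodType K) (phi : composition -> V) a : Llin phi (L a) = phi a.
Proof. exact: (projT2 (cid (L_ext phi))). Qed.

Lemma Llin_uniq (V : lmodType K) (f g : {linear QSym -> V}) :
  (forall a, f (L a) = g (L a)) -> f =1 g.
Proof.
move=> fg; apply: (tri_uniq refines_refl L_mu (fun=> oner_neq0 K)) => a.
by rewrite -L_tri.
Qed.

Lemma ppi_gt0 a : all (ltn 0) a -> (0 < ppi a)%N.
Proof.
suff gt0 y : all (ltn 0) a -> (0 < \prod_(s <- scanl addn y a) s)%N by exact: gt0.
elim: a y => [|x a IH] y /=; first by rewrite big_nil.
by case/andP => x0 /IH h; rewrite big_cons muln_gt0 h addn_gt0 x0 orbT.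
Qed.

Lemma psi_mu (a b : composition) : sumn b = sumn a -> refines a b -> b != a ->
  (size b < size a)%N.
Proof. by move=> _ rb ba; apply: refines_size; rewrite // eq_sym. Qed.

Lemma psi_diag (a : composition) : (ppi2 a a)%:R^-1 != 0 :> K.
Proof.
rewrite invr_neq0 // pnatr_eq0 -lt0n /ppi2 big_seq; apply: prodn_cond_gt0 => t tin.
apply: ppi_gt0; have /andP[/eqP fa _] := refines_refl a.
apply/allP => x xt; apply: (allP (comp_gt0 a)).
by rewrite -[X in x \in X]fa; apply/flattenP; exists t.
Qed.

(** (psi_a) is a basis: any f has exactly one expansion in it. *)
Lemma psi_expansion (f : QSym) :
  exists! c : {fsfun composition -> K with 0}, f = \sum_(b <- finsupp c) c b *: psi b.
Proof.
have [g gE] := tri_ext (e := fun a b => (ppi2 a b)%:R^-1) refines_refl psi_mu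
  psi_diag (fun a => << a >> : {malg K[composition]}).
have sumE (c : {fsfun composition -> K with 0}) :
    g (\sum_(b <- finsupp c) c b *: psi b) = mkmalg c.
  rewrite linear_sum [RHS]monalgE; apply: eq_bigr => b _.
  rewrite linearZ /= gE; apply/malgP => d.
  by rewrite mcoeffZ !mcoeffU; case: eqP => _; rewrite /= ?mulr1 ?mulr0.
exists (malg_val (g f)); split=> [|c ->]; last by rewrite sumE.
pose h (t : {malg K[composition]}) := \sum_(b <- msupp t) t@_b *: psi b.
have hE t (D : {fset composition}) : (msupp t `<=` D)%fset ->
    h t = \sum_(b <- D) t@_b *: psi b.
  move=> tD; rewrite /h; apply: big_fset_incl => // b _ bt.
  by rewrite mcoeff_outdom // scale0r.
have hlin : linear h.
  move=> c s t; pose D := (msupp s `|` msupp t)%fset.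
  rewrite (hE s D) ?fsubsetUl // (hE t D) ?fsubsetUr // (hE _ D); last first.
    apply: fsubset_trans (msuppD_le _ _) _; apply: fsetSU; exact: msuppZ_le.
  rewrite scaler_sumr -big_split /=; apply: eq_bigr => b _.
  by rewrite mcoeffD mcoeffZ scalerDl scalerA.
pose hL := HB.pack_for {linear {malg K[composition]} -> QSym} h
  (GRing.isLinear.Build _ _ _ _ h hlin).
have : (idfun : {linear QSym -> QSym}) =1 (hL \o g)%FUN; last exact.
apply: (tri_uniq (e := fun a b => (ppi2 a b)%:R^-1)
  refines_refl psi_mu psi_diag) => a /=.
by rewrite gE /h msuppU oner_eq0 big_seq_fset1 mcoeffUU scale1r.
Qed.

Definition omegarho : {linear QSym -> QSym} := Llin (fun a => L (compl a)).

Lemma omegarhoK : involutive omegarho.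
Proof.
have : (omegarho \o omegarho)%FUN =1 (idfun : {linear QSym -> QSym}); last exact.
by apply: Llin_uniq => a /=; rewrite !LlinE complK.
Qed.

(** (-1)^k if a = (n-k, 1^k) with 0 <= k < n = |a|, and 0 otherwise. *)
Definition hook_sign (a : composition) : K :=
  if [pick k : 'I_(sumn a) | parts a == (sumn a - k)%N :: nseq k 1%N] is Some k
  then (-1) ^+ k else 0.

Definition MaxOne : {linear QSym -> K^o} := Llin (hook_sign : composition -> K^o).

(** The direct sum of the tensor powers of QSym over all l >= 0: it has for basis
    the words [:: a_1; ...; a_l] of compositions, << [:: a_1; ...; a_l] >> standing
    for M_{a_1} (x) ... (x) M_{a_l}. *)
Definition tensor := {malg K[seq composition]}.

HB.instance Definition _ := GRing.Lmodule.on tensor.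

Definition Tlin_fun (V : lmodType K) (phi : seq composition -> V) (t : tensor) : V :=
  \sum_(w <- msupp t) t@_w *: phi w.

Lemma Tlin_linear (V : lmodType K) (phi : seq composition -> V) : linear (Tlin_fun phi).
Proof.
have hE t (D : {fset seq composition}) : (msupp t `<=` D)%fset ->
    Tlin_fun phi t = \sum_(w <- D) t@_w *: phi w.
  move=> tD; rewrite /Tlin_fun; apply: big_fset_incl => // b _ bt.
  by rewrite mcoeff_outdom // scale0r.
move=> c s t; pose D := (msupp s `|` msupp t)%fset.
rewrite (hE s D) ?fsubsetUl // (hE t D) ?fsubsetUr // (hE _ D); last first.
  apply: fsubset_trans (msuppD_le _ _) _; apply: fsetSU; exact: msuppZ_le.
rewrite scaler_sumr -big_split /=; apply: eq_bigr => b _.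
by rewrite mcoeffD mcoeffZ scalerDl scalerA.
Qed.

HB.instance Definition _ (V : lmodType K) (phi : seq composition -> V) :=
  GRing.isLinear.Build K tensor V *:%R (Tlin_fun phi) (Tlin_linear phi).

(** The linear map taking prescribed values on basis tensors. *)
Definition Tlin (V : lmodType K) (phi : seq composition -> V) : {linear tensor -> V} :=
  Tlin_fun phi.

Lemma TlinE (V : lmodType K) (phi : seq composition -> V) w : Tlin phi << w >> = phi w.
Proof. by rewrite /= /Tlin_fun msuppU oner_eq0 big_seq_fset1 mcoeffUU scale1r. Qed.

Definition Delta : {linear QSym -> tensor} :=
  Mlin (fun a => \sum_(k < (size a).+1) << [:: ctake k a; cdrop k a] >> : tensor).

(** Delta (x) id (x) ... (x) id. *)
Definition Delta_head : {linear tensor -> tensor} :=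
  Tlin (fun w => if w is a :: w'
                 then Tlin (fun u => << u ++ w' >> : tensor) (Delta (M a))
                 else 0).

Definition counit : {linear QSym -> K^o} := Mlin (fun a => (nilp a)%:R : K^o).

(** The (l-1)-fold iterated coproduct QSym -> QSym^{(x) l}; for l = 0 it is the
    counit, with values in QSym^{(x) 0} = K. *)
Definition Delta_iter (l : nat) (f : QSym) : tensor :=
  if l is k.+1 then
    iter k Delta_head (Mlin (fun a => << [:: a] >> : tensor) f)
  else << counit f *g [::] >>.

(** Projection onto QSym_{g_1} (x) ... (x) QSym_{g_l}. *)
Definition tensor_proj (g : seq nat) : {linear tensor -> tensor} :=
  Tlin (fun w => if map (fun a : composition => sumn a) w == g
                 then << w >> : tensor else 0).

Definition Delta_comp (g : composition) (f : QSym) : tensor :=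
  tensor_proj g (Delta_iter (size g) f).

(** Restricts to MaxOne^{(x) l} on the l-th tensor power, for every l. *)
Definition MaxOne_tensor : {linear tensor -> K^o} :=
  Tlin (fun w => \prod_(a <- w) MaxOne (M a) : K^o).

End QSym.

(* Main.v *)
Require Import Defs.
From HB Require Import structures.
From mathcomp Require Import all_boot all_order all_algebra.
From mathcomp Require Import finmap monalg complex.
From mathcomp Require Import boolp reals functions.

Set Implicit Arguments.
Unset Strict Implicit.
Unset Printing Implicit Defensive.

Import Order.TTheory GRing.Theory Num.Theory.

Local Open Scope ring_scope.

(* Let Psi_n be the functional extracting the coefficient of psi_(n). Since
   Delta(psi_a) = sum_(a = b c) psi_b (x) psi_c, the coefficient of psi_beta in f
   is (Psi_beta1 (x) ... (x) Psi_betal)(Delta_beta f). On the fundamental basis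
   Psi_n is (-1)^k at L_(1^k, n-k) and 0 elsewhere, so that Psi_n o omegarho is
   (-1)^(n-1) MaxOne in degree n. Finally omegarho is a coalgebra morphism: the
   component of Delta(L_a) in degrees (p, q) is L_a1 (x) L_a2 for the cut of a at
   p, and cutting commutes with complementation of descent sets. *)

(** * Convolution of functionals dual to deconcatenation *)

Section Convolution.
Variable K : fieldType.
Implicit Types (f g phi : seq nat -> K) (s b : seq nat).

(* Functionals on QSym are represented by their values on the monomial basis;
   [dconv] is the convolution dual to deconcatenation. *)
Definition dconv f g s : K := \sum_(k < (size s).+1) f (take k s) * g (drop k s).

Definition deg n f s : K := if sumn s == n then f s else 0.

(* The convolution product of the degree [rb_i] parts of [phi], taken in the order
   of [rev rb]: the iterated coproduct of [Delta_iter] splits off the last tensor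
   factor first. *)
Fixpoint convprod phi (rb : seq nat) : seq nat -> K :=
  if rb is n :: rb' then dconv (convprod phi rb') (deg n phi) else fun s => (nilp s)%:R.

Lemma eq_dconv f f' g g' s : (forall k, f (take k s) = f' (take k s)) ->
  (forall k, g (drop k s) = g' (drop k s)) -> dconv f g s = dconv f' g' s.
Proof. by move=> ef eg; apply: eq_bigr => k _; rewrite ef eg. Qed.

Lemma dconv_nil f g : dconv f g [::] = f [::] * g [::].
Proof. by rewrite /dconv big_ord1. Qed.

(** Either the cut falls after [x] and the right factor is empty, or [x] ends the right factor. *)
Lemma dconv_rcons f g x s :
  dconv f g (rcons s x) = f (rcons s x) * g [::] + dconv f (g \o rcons^~ x) s.
Proof.
rewrite /dconv size_rcons big_ord_recr /= addrC -(size_rcons s x) take_size drop_size.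
congr (_ + _); rewrite size_rcons; apply: eq_bigr => k _.
by rewrite drop_rcons ?takel_cat -?cats1 ?takel_cat // -ltnS.
Qed.

Lemma dconv_delta_r f g s : (forall t, t != [::] -> g t = 0) ->
  dconv f g s = f s * g [::].
Proof.
move=> g0; rewrite /dconv big_ord_recr /= take_size drop_size big1 ?add0r // => k _.
by rewrite g0 ?mulr0 // -size_eq0 size_drop subn_eq0 -ltnNge.
Qed.

Lemma dconv_nilp g s : dconv (fun t => (nilp t)%:R) g s = g s.
Proof.
rewrite /dconv big_ord_recl take0 drop0 mul1r big1 ?addr0 // => k _.
by case: s k => [[]|x s k] //=; rewrite mul0r.
Qed.

Lemma deg_nil n f : (0 < n)%N -> deg n f [::] = 0.
Proof. by case: n. Qed.

Lemma convprod_nil phi rb : all (ltn 0) rb -> convprod phi rb [::] = (nilp rb)%:R.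
Proof. by case: rb => //= n rb /andP[n0 _]; rewrite dconv_nil deg_nil ?mulr0. Qed.

End Convolution.

(** * The iterated coproduct followed by [MaxOne], as a convolution product *)

Section Coproduct.
Variable K : numFieldType.

(* [M_s], with junk value [0] if [s] has a zero part *)
Definition Ms (s : seq nat) : QSym K := oapp (@M K) 0 (insub s).

Lemma Ms_parts (a : composition) : Ms a = M K a.
Proof. by rewrite /Ms valK. Qed.

Lemma Tlin_comp (V W : lmodType K) (h : {linear V -> W}) (phi : seq composition -> V) t :
  h (Tlin phi t) = Tlin (h \o phi) t.
Proof.
rewrite /= /Tlin_fun linear_sum; apply: eq_bigr => w _.
by rewrite linearZ.
Qed.

Definition MaxOne_word (g : seq nat) (w : seq composition) : K :=
  if map (fun a : composition => sumn a) w == g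
  then \prod_(a <- w) MaxOne K (M K a) else 0.

Lemma MaxOne_proj g (t : tensor K) :
  MaxOne_tensor K (tensor_proj K g t) = Tlin (MaxOne_word g : _ -> K^o) t.
Proof.
rewrite /tensor_proj Tlin_comp; congr (Tlin _ t); apply: funext => w /=.
rewrite /MaxOne_word; case: ifP => _; last by rewrite linear0.
exact: TlinE.
Qed.

Lemma Delta_head_cons a w :
  Delta_head K << a :: w >> = \sum_(k < (size a).+1) << [:: ctake k a, cdrop k a & w] >>.
Proof.
rewrite /Delta_head TlinE /Delta MlinE linear_sum; apply: eq_bigr => k _.
by rewrite TlinE.
Qed.

Lemma iter_Delta_head k : linear (iter k (Delta_head K)).
Proof. by elim: k => // k IH c x y /=; rewrite IH linearP. Qed.

Lemma iter_Delta_head_sum k (I : Type) (r : seq I) (t : I -> tensor K) :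
  iter k (Delta_head K) (\sum_(i <- r) t i) = \sum_(i <- r) iter k (Delta_head K) (t i).
Proof.
elim: k r t => // k IH r t; rewrite iterS IH linear_sum.
by apply: eq_bigr.
Qed.

(** [Delta_head] only splits the first letter, so [w], of degrees [g], is already final. The
    induction varies [g] and [w]: the suffix of [a] split off joins [w], and its degree [n] joins
    [g]. *)
Lemma MaxOne_word_iter (rb : seq nat) n (g : seq nat) (a : composition) w :
  size w = size g ->
  Tlin (MaxOne_word (catrev (n :: rb) g) : _ -> K^o)
    (iter (size rb) (Delta_head K) << a :: w >>) =
  convprod (fun s => MaxOne K (Ms s)) (n :: rb) a * MaxOne_word g w.
Proof.
elim: rb n g a w => [|n' rb IH] n g a w sw.
  rewrite [LHS]TlinE /= dconv_nilp.
  rewrite /MaxOne_word /= eqseq_cons /deg Ms_parts; case: eqP => _ /=; rewrite ?mul0r //.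
  by rewrite big_cons; case: ifP; rewrite ?mulr0.
rewrite iterSr Delta_head_cons iter_Delta_head_sum linear_sum.
rewrite [convprod _ _]/= /dconv -/(convprod _ _) mulr_suml; apply: eq_bigr => k _.
rewrite (IH n' (n :: g)) /= ?sw // -mulrA; congr (_ * _).
rewrite /MaxOne_word /= eqseq_cons /deg -[drop k a]/(parts (cdrop k a)) Ms_parts.
case: eqP => _ /=; rewrite ?mul0r //.
by rewrite big_cons; case: ifP; rewrite ?mulr0.
Qed.

Lemma MaxOne_Delta_M (b a : composition) :
  MaxOne_tensor K (Delta_comp b (M K a)) = convprod (fun s => MaxOne K (Ms s)) (rev b) a.
Proof.
rewrite /Delta_comp MaxOne_proj; case: b => b pb /=.
case/lastP: b {pb} => [|b n] /=.
  rewrite /counit MlinE.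
  have -> : << (nilp a)%:R *g [::] >> = (nilp a)%:R *: (<< [::] >> : tensor K).
    by apply/malgP => w; rewrite mcoeffZ !mcoeffU mulrnAr mulr1.
  by rewrite linearZ /= [X in _ *: X]TlinE /MaxOne_word /= big_nil [_ *: _]mulr1.
rewrite size_rcons /= MlinE -(size_rev b) rev_rcons.
have -> : rcons b n = catrev (n :: rev b) [::] by rewrite -[catrev _ _]/(rev _) rev_cons revK.
by rewrite MaxOne_word_iter // /MaxOne_word /= big_nil mulr1.
Qed.

Lemma Delta_comp_linear b : linear (@Delta_comp K b).
Proof.
move=> c x y; rewrite /Delta_comp; case: (size b) => [|k]; rewrite /Delta_iter.
  rewrite -linearP; congr (tensor_proj K b _); rewrite linearP.
  apply/malgP => w; rewrite mcoeffD mcoeffZ !mcoeffU.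
  by case: (_ == _); rewrite ?mulr1n ?mulr0n ?mulr0 ?addr0.
by rewrite linearP iter_Delta_head linearP.
Qed.

Lemma MaxOne_Delta (b : composition) f :
  MaxOne_tensor K (Delta_comp b f) =
  Mlin (fun a : composition => convprod (fun s => MaxOne K (Ms s)) (rev b) a : K^o) f.
Proof.
pose D := HB.pack_for {linear QSym K -> tensor K} (@Delta_comp K b)
  (GRing.isLinear.Build _ _ _ _ (@Delta_comp K b) (@Delta_comp_linear b)).
have : (MaxOne_tensor K \o D)%FUN =1
  Mlin (fun a : composition => convprod (fun s => MaxOne K (Ms s)) (rev b) a : K^o).
  by apply: Mlin_uniq => a; rewrite MlinE -MaxOne_Delta_M.
exact.
Qed.

End Coproduct.

(** * Nonempty compositions as descent words: refinement and complement *)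

Definition inc_head (s : seq nat) : seq nat := (head 0%N s).+1 :: behead s.

(* The composition of [(size w).+1] whose descent set has indicator word [w]. *)
Fixpoint of_bits (w : bitseq) : seq nat :=
  if w is b :: w' then if b then 1%N :: of_bits w' else inc_head (of_bits w')
  else [:: 1%N].

Lemma of_bits_neq0 w : of_bits w != [::].
Proof. by case: w => [|[] w]. Qed.

Lemma of_bits_gt0 w : all (ltn 0) (of_bits w).
Proof. by elim: w => [|[] w] //=; case: (of_bits w) => //= x s /andP[]. Qed.

Lemma sumn_of_bits w : sumn (of_bits w) = (size w).+1.
Proof.
elim: w => [|[] w IH] //=; first by rewrite IH.
by have := of_bits_neq0 w; case: (of_bits w) IH => //= x s <-.
Qed.

Lemma of_bits_inj : injective of_bits.
Proof.
elim=> [|b v IH] [|c w] //.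
- case: c => /= [[] e|[e]]; first by have := of_bits_neq0 w; rewrite -e.
  have := of_bits_gt0 w; have := of_bits_neq0 w; case: (of_bits w) e => //= x s e.
  by rewrite -e.
- case: b => /= [[] e|[e]]; first by have := of_bits_neq0 v; rewrite e.
  have := of_bits_gt0 v; have := of_bits_neq0 v; case: (of_bits v) e => //= x s e.
  by rewrite e.
have := of_bits_gt0 w; have := of_bits_neq0 w.
have := of_bits_gt0 v; have := of_bits_neq0 v.
case: b; case: c => /=.
- by move=> _ _ _ _ [/IH ->].
- by case: (of_bits w) => //= x s _ _ _ /andP[x0 _] [e]; rewrite -e in x0.
- by case: (of_bits v) => //= x s _ /andP[x0 _] _ _ [e]; rewrite e in x0.
case ev: (of_bits v) => [//|x s] _ _; case ew: (of_bits w) => [//|y t] _ _ /= [exy est].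
by rewrite (IH w) // ev ew exy est.
Qed.

Lemma of_bits_surj s : all (ltn 0) s -> s != [::] -> {w | s = of_bits w}.
Proof.
have [n] := ubnP (sumn s); elim: n s => // n IH [//|[//|[|x]] s] /= lt ps _.
  have [->|s0] := eqVneq s [::]; first by exists [::].
  by have [w ->] := IH s lt ps s0; exists (true :: w).
have [w e] := IH (x.+1 :: s) lt ps isT; exists (false :: w).
by rewrite /= -e.
Qed.

(** A letter [true] is a descent, so the composition breaks there. *)
Lemma of_bits_cat u v : of_bits (u ++ true :: v) = of_bits u ++ of_bits v.
Proof.
elim: u => //= -[] u -> //.
by have := of_bits_neq0 u; case: (of_bits u).
Qed.

Lemma scanl_addSn x s : scanl addn x.+1 s = map S (scanl addn x s).
Proof. by elim: s x => //= y s IH x; rewrite -IH. Qed.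

(** The leading 1 raises the partial sums and the target of the first block alike, so the greedy cut
    stays in place; [0 < y] keeps it from falling right after the 1. *)
Lemma blocks_S1 a b y : (0 < y)%N ->
  blocks (1%N :: a) (y.+1 :: b) =
  if blocks a (y :: b) is s :: t then (1%N :: s) :: t else [::].
Proof.
move=> y0 /=; rewrite addn1 ltnS leqNgt y0 /= scanl_addSn find_map.
by congr ((_ :: take _ _) :: blocks (drop _ _) _); congr _.+1; apply: eq_find.
Qed.

Lemma blocks_SS a b x y : (0 < y)%N ->
  blocks (x.+1 :: a) (y.+1 :: b) =
  if blocks (x :: a) (y :: b) is s :: t then inc_head s :: t else [::].
Proof.
move=> y0 /=; rewrite !add0n ltnS /inc_head.
case: leqP => //= _; rewrite scanl_addSn find_map.
by congr ((_ :: take _ _) :: blocks (drop _ _) _); apply: eq_find.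
Qed.

(** This and the next three lemmas treat the four pairs of leading letters; together they make
    refinement the letterwise domination of words. *)
Lemma refines_11 a b : refines (1%N :: a) (1%N :: b) = refines a b.
Proof. by rewrite /refines /= take0 drop0 /= !eqseq_cons !eqxx. Qed.

Lemma refines_S1 a b : b != [::] -> all (ltn 0) b ->
  refines (1%N :: a) (inc_head b) = refines a b.
Proof.
by case: b => //= y b _ /andP[y0 _]; rewrite /refines -[inc_head _]/(y.+1 :: b) blocks_S1 //.
Qed.

Lemma refines_SS a b : a != [::] -> b != [::] -> all (ltn 0) b ->
  refines (inc_head a) (inc_head b) = refines a b.
Proof.
case: a => // x a _; case: b => //= y b _ /andP[y0 _].
by rewrite /refines /inc_head blocks_SS.
Qed.

Lemma refines_1S a b : a != [::] -> all (ltn 0) a ->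
  refines (inc_head a) (1%N :: b) = false.
Proof.
case: a => //= x a _ /andP[x0 _]; rewrite /refines /= take0 /= eqseq_cons.
by case: x x0 => // x; rewrite /= andbF.
Qed.

(* The words dominating [w]: they index the monomials of [L_(of_bits w)]. *)
Fixpoint dominating (w : bitseq) : seq bitseq :=
  if w is b :: w' then
    map (cons true) (dominating w') ++
    (if b then [::] else map (cons false) (dominating w'))
  else [:: [::]].

(** The recursion of [comps_seq] prepends a part 1 or increments the first part, exactly as
    [of_bits] reads a letter, so the two lists agree even in order. *)
Lemma refining_bits w :
  [seq s <- comps_seq (size w).+1 | refines s (of_bits w)] =
  map of_bits (dominating w).
Proof.
elim: w => [|b w IH] //.
have mC s : s \in comps_seq (size w).+1 -> (s != [::]) && all (ltn 0) s.
  by rewrite mem_comps_seq => /andP[ps ss]; rewrite ps andbT; case: s ss {ps}.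
have pw := of_bits_gt0 w; have w0 := of_bits_neq0 w.
rewrite [size _]/= [comps_seq _.+1.+1]/= -/(comps_seq (size w).+1).
rewrite -[dominating _]/(map (cons true) (dominating w) ++
    (if b then [::] else map (cons false) (dominating w))).
move: (comps_seq _) IH mC => C IH mC.
rewrite filter_cat map_cat; congr (_ ++ _).
  transitivity (map (cons 1%N) (map of_bits (dominating w))); last by rewrite -!map_comp.
  rewrite filter_map -IH; congr map; apply: eq_in_filter => s sC /=.
  by case: b; rewrite ?refines_11 ?refines_S1.
rewrite filter_map.
have -> : [seq s <- C | s != [::]] = C.
  by apply/all_filterP/allP => s /mC /andP[].
case: b.
  rewrite (eq_in_filter (a2 := pred0)) ?filter_pred0 // => s /mC /andP[s0 ps] /=.
  exact: refines_1S.
transitivity (map inc_head (map of_bits (dominating w))); last by rewrite -!map_comp.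
rewrite -IH; congr map; apply: eq_in_filter => s /mC /andP[s0 ps].
exact: refines_SS.
Qed.

Fixpoint bits_descents (w : bitseq) : seq nat :=
  if w is b :: w' then nseq b 1%N ++ map S (bits_descents w') else [::].

Lemma descents_of_bits w : descents (of_bits w) = bits_descents w.
Proof.
elim: w => // -[] w IH /=; rewrite -IH /descents.
  have := of_bits_neq0 w; case: (of_bits w) => // x s _ /=.
  by rewrite scanl_addSn map_take.
have := of_bits_neq0 w; case: (of_bits w) => // x s _ /=.
by rewrite !add0n scanl_addSn map_take.
Qed.

Lemma bits_descents_negb w :
  [seq i <- iota 1 (size w) | i \notin bits_descents w] =
  bits_descents (map negb w).
Proof.
elim: w => // b w IH; rewrite [size _]/= [iota _ _]/= -[2%N]/(1 + 1)%N iotaDl.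
have d0 : 0%N \notin bits_descents w
  by case: w {IH} => //= -[] w; rewrite ?inE; apply/negP => /mapP[].
rewrite /= -IH mem_cat (mem_map succn_inj) (negPf d0) orbF filter_map.
have -> : [seq x <- iota 1 (size w) | preim (addn 1)
     (fun i => i \notin nseq b 1%N ++ [seq j.+1 | j <- bits_descents w]) x] =
   [seq i <- iota 1 (size w) | i \notin bits_descents w].
  apply: eq_in_filter => i; rewrite mem_iota => /andP[i0 _] /=.
  rewrite mem_cat add1n (mem_map succn_inj); case: b => //=.
  by rewrite inE eqSS; case: i i0.
by case: b.
Qed.

(** A composition consists of the differences of its descents and its sum; negating the word
    complements the descents and keeps the sum. *)
Lemma compl_of_bits w : compl_seq (of_bits w) = of_bits (map negb w).
Proof.
rewrite /compl_seq sumn_of_bits /= /codescents sumn_of_bits descents_of_bits /=.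
rewrite bits_descents_negb -descents_of_bits.
have <- : sumn (of_bits (map negb w)) = (size w).+1 by rewrite sumn_of_bits size_map.
by rewrite rcons_descents ?of_bits_neq0 // pairmap_sub_scanl.
Qed.

(** * Functionals on the fundamental basis, and complementation *)

Section FundamentalBasis.
Variable K : numFieldType.
Implicit Types (f g phi : seq nat -> K).

(** The value at $L_a$, for [a] with descent word [w], of the functional with values [phi] on the
    monomial basis. *)
Definition Lsum phi w : K := \sum_(v <- dominating w) phi (of_bits v).

Lemma map_val_comps n : map parts (comps n) = comps_seq n.
Proof.
rewrite /comps pmap_filter; last exact: insubK.
apply/all_filterP/allP => s; rewrite mem_comps_seq => /andP[ps _].
by rewrite /= insubT.
Qed.

Lemma big_comps (V : nmodType) n (P : pred (seq nat)) (F : seq nat -> V) :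
  \sum_(b <- comps n | P (parts b)) F (parts b) = \sum_(s <- comps_seq n | P s) F s.
Proof. by rewrite -map_val_comps big_map. Qed.

Lemma L_bits (F : {linear QSym K -> K^o}) (a : composition) w : parts a = of_bits w ->
  F (L K a) = Lsum (fun s => F (Ms K s)) w.
Proof.
move=> aw; rewrite /L linear_sum aw sumn_of_bits /Lsum.
under eq_bigr do rewrite -Ms_parts.
rewrite (big_comps (V := K^o) _ (fun s => refines s (of_bits w)) (fun s => F (Ms K s))).
by rewrite -big_filter refining_bits big_map.
Qed.

Lemma size_dominating w v : v \in dominating w -> size v = size w.
Proof.
elim: w v => [|b w IH] v /=; first by rewrite inE => /eqP ->.
rewrite mem_cat => /orP[/mapP[u uw ->]|]; first by rewrite /= IH.
by case: b => // /mapP[u uw ->]; rewrite /= IH.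
Qed.

Lemma sumn_take_drop k (s : seq nat) : (sumn (take k s) + sumn (drop k s))%N = sumn s.
Proof. by rewrite -sumn_cat cat_take_drop. Qed.

(** Both pieces are nonempty, hence have words; joined by [true] these give the whole word, and
    comparing lengths identifies the letters. *)
Lemma of_bits_split u x v k : sumn (drop k (of_bits (u ++ x :: v))) = (size v).+1 ->
  [/\ x, take k (of_bits (u ++ x :: v)) = of_bits u &
      drop k (of_bits (u ++ x :: v)) = of_bits v].
Proof.
set s := of_bits _ => e.
have ps : all (ltn 0) s := of_bits_gt0 _.
have [v' ev'] : {v' | drop k s = of_bits v'}.
  apply: of_bits_surj; last by apply: contra_eq_neq e => ->.
  by apply/allP => y /mem_drop; apply/allP.
have [u' eu'] : {u' | take k s = of_bits u'}.
  apply: of_bits_surj; first by apply/allP => y /mem_take; apply/allP.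
  apply/eqP => e0; have := sumn_take_drop k s.
  rewrite e0 e sumn_of_bits size_cat /= add0n => -[] /eqP.
  by rewrite addnS -addSn -{1}[size v]add0n eqn_add2r.
have es : u ++ x :: v = u' ++ true :: v'.
  by apply: of_bits_inj; rewrite of_bits_cat -eu' -ev' cat_take_drop.
move: e; rewrite ev' sumn_of_bits => -[sv].
have su : size u = size u'.
  move/(congr1 size): es; rewrite !size_cat /= sv => /eqP.
  by rewrite eqn_add2r => /eqP.
by move/eqP: es; rewrite eqseq_cat // => /andP[/eqP -> /eqP[-> ->]].
Qed.

(** A cut with degree $|v|+1$ on its right exists only if [x] is a descent, and is then unique. *)
Lemma dconv_deg_bits f g u x v :
  dconv f (deg (size v).+1 g) (of_bits (u ++ x :: v)) =
  if x then f (of_bits u) * g (of_bits v) else 0.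
Proof.
case: x; rewrite /dconv; last first.
  rewrite big1 // => k _; rewrite /deg; case: eqP => [|_]; last by rewrite mulr0.
  by case/of_bits_split.
have lu : (size (of_bits u) < (size (of_bits (u ++ true :: v))).+1)%N.
  by rewrite of_bits_cat size_cat ltnS leq_addr.
rewrite (bigD1 (Ordinal lu)) //= {1 2}of_bits_cat take_size_cat // drop_size_cat //.
rewrite /deg sumn_of_bits eqxx big1 ?addr0 // => k; rewrite -val_eqE /= => ku.
case: eqP => [|_]; last by rewrite mulr0.
case/of_bits_split => _ e _; case/eqP: ku; rewrite -e size_takel //.
by rewrite -ltnS.
Qed.

Lemma dconv_deg_full f g v :
  dconv f (deg (size v).+1 g) (of_bits v) = f [::] * g (of_bits v).
Proof.
rewrite /dconv big_ord_recl take0 drop0 /deg sumn_of_bits eqxx big1 ?addr0 // => k _.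
case: eqP => [e|_]; last by rewrite mulr0.
(* A cut after at least one part removes a positive sum, so the right piece cannot keep the full
   degree. *)
have := sumn_take_drop (bump 0 k) (of_bits v); rewrite e sumn_of_bits.
move/(congr1 (subn^~ (size v).+1)); rewrite addnK subnn => e0; exfalso; move: e0.
have := of_bits_neq0 v; have := of_bits_gt0 v.
by move: (nat_of_ord k) => i {e}; case: (of_bits v) => //= -[].
Qed.

Lemma dconv_deg_big f g n v : ((size v).+1 < n)%N ->
  dconv f (deg n g) (of_bits v) = 0.
Proof.
move=> vn; rewrite /dconv big1 // => k _; rewrite /deg.
case: eqP => [e|_]; last by rewrite mulr0.
by move: vn; rewrite -e -sumn_of_bits -(sumn_take_drop k (of_bits v)) ltnNge leq_addl.
Qed.

Lemma Lsum_dconv_full f g w :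
  Lsum (dconv f (deg (size w).+1 g)) w = f [::] * Lsum g w.
Proof.
rewrite /Lsum mulr_sumr big_seq [RHS]big_seq; apply: eq_bigr => v vw.
by rewrite -(size_dominating vw) dconv_deg_full.
Qed.

Lemma Lsum_dconv_big f g n w : ((size w).+1 < n)%N ->
  Lsum (dconv f (deg n g)) w = 0.
Proof.
move=> wn; rewrite /Lsum big_seq big1 // => v vw.
by rewrite dconv_deg_big ?(size_dominating vw).
Qed.

Lemma big_dominating_cat (F : bitseq -> K) u w :
  \sum_(v <- dominating (u ++ w)) F v =
  \sum_(v1 <- dominating u) \sum_(v2 <- dominating w) F (v1 ++ v2).
Proof.
elim: u F => [|b u IH] F /=; first by rewrite big_seq1.
rewrite !big_cat !big_map /= IH; congr (_ + _).
by case: b; rewrite ?big_nil // !big_map IH.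
Qed.

(* The coproduct of [L_a] in degrees [(p, q)] is [L_a1 (x) L_a2], for the cut
   of [a] at [p], whether or not [p] is a descent. *)
Lemma Lsum_dconv f g u x v :
  Lsum (dconv f (deg (size v).+1 g)) (u ++ x :: v) = Lsum f u * Lsum g v.
Proof.
rewrite /Lsum big_dominating_cat mulr_suml; apply: eq_bigr => u' _ /=.
rewrite big_cat big_map /= mulr_sumr.
(* Only dominating words with [true] at the place of [x] can be cut there. They occur for either
   value of [x], whence the independence of [x]. *)
rewrite [X in _ + X]big1_seq ?addr0.
  rewrite big_seq [RHS]big_seq; apply: eq_bigr => v' v'v.
  by rewrite -(size_dominating v'v) dconv_deg_bits.
move=> v' /=; case: x => // /mapP[v'' v''v ->].
by rewrite -(size_dominating v''v) dconv_deg_bits.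
Qed.

(** Cutting commutes with negating the word, so the one-factor comparison passes to products; a
    factor of degree $n$ contributes $(-1)^{n-1}$. *)
Lemma Lsum_convprod phi phi' rb w :
  (forall w, Lsum phi' (map negb w) = (-1) ^+ size w * Lsum phi w) ->
  all (ltn 0) rb ->
  Lsum (convprod phi' rb) (map negb w) =
  (-1) ^+ (sumn rb - size rb) * Lsum (convprod phi rb) w.
Proof.
move=> H; elim: rb w => [|n rb IH] w /=.
  move=> _; rewrite expr0 mul1r /Lsum !big1 // => v _.
    by have := of_bits_neq0 v; case: (of_bits v).
  by have := of_bits_neq0 v; case: (of_bits v).
case: n => // n /= prb.
have szrb : (size rb <= sumn rb)%N := size_le_sumn (Composition prb).
have -> : (n.+1 + sumn rb - (size rb).+1 = n + (sumn rb - size rb))%N.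
  by rewrite addSn subSS addnBA.
(* The split-off factor has degree [n.+1] and [w] has degree $|w|+1$: the factor is too large, takes
   everything, or leaves a proper cut. *)
have [wn|nw] := ltnP (size w) n.
  by rewrite !Lsum_dconv_big ?size_map ?mulr0 // ltnS.
have [->|nw'] := eqVneq n (size w).
  rewrite -{1}(size_map negb w) !Lsum_dconv_full !convprod_nil // H.
  by case: rb {IH prb szrb} => [|? ?] /=; rewrite ?mul0r ?mulr0 // !mul1r addn0.
have {nw nw'} nw : (n < size w)%N by rewrite ltn_neqAle nw'.
(* Degree [n.+1] on the right uses the last [n] letters; [x] is the letter at the cut. *)
have [u [x [v [-> ev]]]] : exists u x v, w = u ++ x :: v /\ size v = n.
  exists (take (size w - n.+1) w), (nth false w (size w - n.+1)), (drop (size w - n) w).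
  split; last by rewrite size_drop subKn // ltnW.
  by rewrite -(subnSK nw) -drop_nth ?cat_take_drop // ltn_subrL (leq_ltn_trans _ nw).
rewrite map_cat /= -{1}ev -{1}(size_map negb v) -{2}ev !Lsum_dconv IH // H exprD ev.
by rewrite mulrACA [X in X * _]mulrC.
Qed.

End FundamentalBasis.

(** * Coarsenings as cuts into consecutive nonempty blocks *)

Fixpoint cuts (s : seq nat) : seq (seq (seq nat)) :=
  if s is x :: s' then
    [seq [:: x] :: ss | ss <- cuts s'] ++
    [seq (x :: head [::] ss) :: behead ss | ss <- cuts s' & ss != [::]]
  else [:: [::]].

Lemma mem_cuts s ss :
  (ss \in cuts s) = (flatten ss == s) && all (predC (@nilp nat)) ss.
Proof.
elim: s ss => [|x s IH] ss; first by rewrite inE; case: ss => [|[|y t] ss] //=; rewrite andbF.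
rewrite /= mem_cat; apply/orP/andP => [[]|].
- case/mapP => us; rewrite IH => /andP[/eqP <- ptt] ->.
  by rewrite /= ptt.
- case/mapP => us; rewrite mem_filter IH; case: us => [//|t us] /= /andP[/eqP <- /andP[_ ptt]].
  by move=> ->; rewrite /= ptt.
- case: ss => [[]//|[|y [|z t]] ss] /= [] //.
  + move=> /eqP[-> es] ps; left; apply/mapP; exists ss => //.
    by rewrite IH es eqxx.
  + move=> /eqP[-> es] ps; right; apply/mapP; exists ((z :: t) :: ss) => //.
    by rewrite mem_filter IH /= es eqxx.
Qed.

Lemma cuts_uniq s : uniq (cuts s).
Proof.
elim: s => // x s IH /=; rewrite cat_uniq map_inj_uniq ?IH /=; last by move=> ss us [].
apply/andP; split.
  apply/hasPn => ss /mapP[us]; rewrite mem_filter mem_cuts.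
  case: us => // t us /= /andP[_ /andP[t0 _]] ->.
  by apply/negP => /mapP[u _] [e _]; rewrite e in t0.
rewrite map_inj_in_uniq ?filter_uniq // => ss us.
by rewrite !mem_filter; case: ss => // t ss; case: us => // t' us _ _ /= [-> ->].
Qed.

(** As the parts of [a] are positive, [blocks] recovers a cut from its block sums, so distinct cuts
    give distinct coarsenings. *)
Lemma coarsening_cuts (a : composition) :
  perm_eq [seq s <- comps_seq (sumn a) | refines a s] (map (map sumn) (cuts a)).
Proof.
have pos ss : ss \in cuts a -> all (all (ltn 0)) ss /\ all (predC (@nilp nat)) ss.
  rewrite mem_cuts => /andP[/eqP fa ->]; split=> //.
  apply/allP => s sin; apply/allP => x xs; apply: (allP (comp_gt0 a)).
  by rewrite -fa; apply/flattenP; exists s.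
have bK ss : ss \in cuts a -> blocks a (map sumn ss) = ss.
  move=> ssa; have [p1 p2] := pos ss ssa.
  by move: ssa; rewrite mem_cuts => /andP[/eqP <- _]; rewrite blocks_flatten.
apply: uniq_perm.
- by rewrite filter_uniq // -map_val_comps (map_inj_uniq val_inj) comps_uniq.
- rewrite map_inj_in_uniq ?cuts_uniq // => ss us ssa tta e.
  by rewrite -(bK ss) // e bK.
move=> s; rewrite mem_filter mem_comps_seq.
apply/and3P/mapP => [[/andP[/eqP fa /eqP ms] ps _]|].
  exists (blocks a s); last by rewrite ms.
  rewrite mem_cuts fa eqxx /=; apply/allP => t tb.
  have: sumn t \in s by rewrite -ms map_f.
  by move/(allP ps); case: t {tb}.
case=> ss ssa ->; have [p1 p2] := pos ss ssa.
move: (ssa); rewrite mem_cuts => /andP[/eqP fa _]; split.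
- by rewrite /refines bK // fa !eqxx.
- apply/allP => _ /mapP[t tss ->]; have := allP p1 t tss; have := allP p2 t tss.
  by case: t {tss} => //= x t _ /andP[x0 _]; rewrite addn_gt0 x0.
- by rewrite -fa sumn_flatten.
Qed.

(** * The basis [psi] and its dual functionals *)

Section PowerSums.
Variable K : numFieldType.
Implicit Types (f g phi : seq nat -> K).

Definition ppi_inv (s : seq nat) : K := (ppi s)%:R^-1.

(** The value at $\psi_s$ of the functional [phi], with each coarsening represented by its cut. *)
Definition psum phi (s : seq nat) : K :=
  \sum_(ss <- cuts s) (\prod_(t <- ss) ppi_inv t) * phi (map sumn ss).

Lemma psi_cuts (F : {linear QSym K -> K^o}) (a : composition) :
  F (psi K a) = psum (fun s => F (Ms K s)) a.
Proof.
rewrite /psi linear_sum.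
under eq_bigr do rewrite -Ms_parts linearZ.
rewrite (big_comps (V := K^o) _ (fun s => refines a s)
  (fun s => (ppi2 a s)%:R^-1 *: (F (Ms K s) : K^o))).
rewrite -big_filter (perm_big _ (coarsening_cuts a)) big_map /psum.
rewrite big_seq [RHS]big_seq; apply: eq_bigr => ss; rewrite mem_cuts => /andP[/eqP fa ss0].
rewrite /ppi2 -fa blocks_flatten //; last first.
  apply/allP => s sin; apply/allP => x xs; apply: (allP (comp_gt0 a)).
  by rewrite -fa; apply/flattenP; exists s.
by rewrite /ppi_inv natr_prod prodfV.
Qed.

Lemma big_cuts_cons (F : seq (seq nat) -> K) x s :
  \sum_(ss <- cuts (x :: s)) F ss =
  \sum_(ss <- cuts s) (F ([:: x] :: ss) +
     (if ss is t :: us then F ((x :: t) :: us) else 0)).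
Proof.
rewrite /= big_cat !big_map big_split; congr (_ + _).
by rewrite big_filter big_mkcond; apply: eq_bigr => -[].
Qed.

(* Both sides sum over the cuts of [s] together with a marked separation
   between two blocks. *)
Lemma big_cuts_take_drop (F : seq (seq nat) -> seq (seq nat) -> K) s :
  \sum_(ss <- cuts s) \sum_(k < (size ss).+1) F (take k ss) (drop k ss) =
  \sum_(j < (size s).+1)
    \sum_(ss <- cuts (take j s)) \sum_(us <- cuts (drop j s)) F ss us.
Proof.
elim: s F => [|x s IH] F; first by rewrite /= big_seq1 !big_ord1 /= !big_seq1.
rewrite big_ord_recl take0 drop0 [X in _ = X + _]big_seq1 !big_cuts_cons.
(* The separation in front of [x] is set apart; in all others [x] starts the left piece, as a block
   of its own or inside the first block. *)
transitivity (\sum_(ss <- cuts s) (F [::] ([:: x] :: ss) +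
     (if ss is t :: us then F [::] ((x :: t) :: us) else 0)) +
  \sum_(ss <- cuts s) \sum_(k < (size ss).+1) (F ([:: x] :: take k ss) (drop k ss) +
     (if take k ss is t :: us then F ((x :: t) :: us) (drop k ss) else 0))).
  rewrite -big_split; apply: eq_bigr => ss _ /=.
  rewrite big_ord_recl take0 drop0 big_split /=.
  rewrite -!addrA; congr (_ + _); rewrite addrCA; congr (_ + _).
  case: ss => [|t ss]; first by rewrite big_ord1 addr0.
  by rewrite !big_ord_recl /= add0r.
congr (_ + _).
rewrite (IH (fun ss us => F ([:: x] :: ss) us +
     (if ss is t :: ss' then F ((x :: t) :: ss') us else 0))).
apply: eq_bigr => j _; rewrite [take _ _]/= big_cuts_cons; apply: eq_bigr => ss _.
by rewrite big_split; congr (_ + _); case: ss => [|//]; rewrite big1.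
Qed.

(* [Delta(psi_a)] is the sum of [psi_b (x) psi_c] over [a = b c]. *)
Lemma psum_dconv f g s : psum (dconv f g) s = dconv (psum f) (psum g) s.
Proof.
rewrite /psum /dconv.
pose F ss us := ((\prod_(t <- ss) ppi_inv t) * f (map sumn ss)) *
  ((\prod_(t <- us) ppi_inv t) * g (map sumn us)).
transitivity (\sum_(ss <- cuts s) \sum_(k < (size ss).+1) F (take k ss) (drop k ss)).
  apply: eq_bigr => ss _; rewrite mulr_sumr size_map; apply: eq_bigr => k _.
  by rewrite /F mulrACA -big_cat cat_take_drop map_take map_drop.
rewrite big_cuts_take_drop; apply: eq_bigr => j _.
by rewrite mulr_suml; apply: eq_bigr => ss _; rewrite mulr_sumr.
Qed.

Lemma eq_psum f g s : (forall t, f t = g t) -> psum f s = psum g s.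
Proof. by move=> fg; apply: eq_bigr => ss _; rewrite fg. Qed.

Lemma psum_deg n f s : psum (deg n f) s = deg n (psum f) s.
Proof.
rewrite /psum /deg; case: ifPn => sn.
  rewrite big_seq [RHS]big_seq; apply: eq_bigr => ss; rewrite mem_cuts => /andP[/eqP fs _].
  by rewrite -sumn_flatten fs sn.
rewrite big_seq big1 // => ss; rewrite mem_cuts => /andP[/eqP fs _].
by rewrite -sumn_flatten fs (negPf sn) mulr0.
Qed.

Lemma big_cuts_nil (F : seq (seq nat) -> K) s :
  (forall ss, ss != [::] -> F ss = 0) ->
  \sum_(ss <- cuts s) F ss = (nilp s)%:R * F [::].
Proof.
move=> F0; case: s => [|x s]; first by rewrite big_seq1 mul1r.
rewrite big_cuts_cons mul0r big1 // => ss _; rewrite F0 // add0r.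
by case: ss => // t us; rewrite F0.
Qed.

Lemma big_cuts_single (F : seq (seq nat) -> K) s :
  (forall ss, size ss != 1%N -> F ss = 0) ->
  \sum_(ss <- cuts s) F ss = if nilp s then 0 else F [:: s].
Proof.
elim: s F => [|x s IH] F F0; first by rewrite big_seq1 F0.
rewrite big_cuts_cons big_split /=.
rewrite (big_cuts_nil (F := fun ss => F ([:: x] :: ss))); last first.
  by move=> [] // t us _; rewrite F0.
rewrite (IH (fun ss => if ss is t :: us then F ((x :: t) :: us) else 0)); last first.
  by move=> [|t [|u us]] // _; rewrite F0.
by case: s {IH} => [|y s] /=; rewrite ?mul1r ?addr0 ?mul0r ?add0r.
Qed.

Lemma psum_nilp s : psum (fun t => (nilp t)%:R) s = (nilp s)%:R.
Proof.
rewrite /psum big_cuts_nil; first by rewrite big_nil !mulr1.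
by move=> [] // t ss _; rewrite mulr0.
Qed.

(* The value on [M_s] of the functional extracting the coefficient of [psi_(n)],
   that is, the coefficients of the noncommutative power sum
   [Psi_n] in the complete basis. *)
Definition Psi_coef (s : seq nat) : K :=
  if s is x :: t then (-1) ^+ size t * (last x t)%:R else 0.

(** In noncommutative symmetric functions, [size_le1] is the sum $\sigma$ of the complete functions
    $S_n$, [sgn_size] is $\sigma^{-1}$, and [size1_val] is $\sum_n nS_n$. *)
Definition sgn_size (s : seq nat) : K := (-1) ^+ size s.
Definition size1_val (s : seq nat) : K := if s is [:: x] then x%:R else 0.
Definition size_le1 (s : seq nat) : K := (size s <= 1)%:R.

(** Only the cut just before the last part contributes; this is $\Psi=\sigma^{-1}\sum_n nS_n$. *)
Lemma Psi_coefE s : Psi_coef s = dconv sgn_size size1_val s.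
Proof.
case/lastP: s => [|s x]; first by rewrite dconv_nil mulr0.
rewrite dconv_rcons mulr0 add0r dconv_delta_r; last by move=> [|y [|z t]].
rewrite /sgn_size /size1_val /=.
case: s => [|y s] //=; by rewrite size_rcons last_rcons.
Qed.

(** For nonempty [s] the cuts before and after the last part survive, with opposite signs. *)
Lemma dconv_sgn_size s : dconv sgn_size size_le1 s = (nilp s)%:R.
Proof.
case/lastP: s => [|s x]; first by rewrite dconv_nil mulr1.
rewrite dconv_rcons dconv_delta_r; last first.
  by move=> t t0; rewrite /size_le1 /= size_rcons; case: t t0.
rewrite /sgn_size /size_le1 /= size_rcons exprS !mulr1 mulN1r addNr.
by rewrite /nilp size_rcons.
Qed.

Lemma psum_size_le1 s : psum size_le1 s = ppi_inv s.
Proof.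
transitivity (psum (fun t => (nilp t)%:R) s + psum (fun t => (size t == 1)%:R) s).
  rewrite -big_split; apply: eq_bigr => ss _ /=; rewrite -mulrDr; congr (_ * _).
  by rewrite /size_le1; case: ss => [|t [|u ss]] /=; rewrite ?addr0 ?add0r.
rewrite psum_nilp /psum big_cuts_single /=; last first.
  by move=> ss; rewrite size_map => /negPf ->; rewrite mulr0.
rewrite big_seq1 mulr1; case: s => [|x s] /=; last by rewrite add0r.
by rewrite /ppi_inv /ppi big_nil invr1 addr0.
Qed.

(** Only the one-block cut counts; its value, the total sum, cancels the last factor of [ppi]. *)
Lemma psum_size1_val s x : all (ltn 0) (rcons s x) ->
  psum size1_val (rcons s x) = ppi_inv s.
Proof.
move=> ps; rewrite /psum big_cuts_single; last by move=> [|t [|u ss]] //=; rewrite mulr0.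
rewrite big_seq1 /nilp size_rcons /=.
have sx : (sumn (rcons s x))%:R != 0 :> K.
  move: ps; rewrite all_rcons => /andP[x0 _].
  by rewrite pnatr_eq0 -lt0n -cats1 sumn_cat addn_gt0 /= addn0 (x0 : (0 < x)%N) orbT.
rewrite /ppi_inv /ppi -{1}cats1 scanl_addn_cat /= big_cat big_seq1 /= natrM invfM.
by rewrite add0n -[X in (sumn s + X)%N]addn0 -[(x + 0)%N]/(sumn [:: x]) -sumn_cat cats1 mulfVK.
Qed.

(** On $\psi$, dropping the last part turns [size1_val] into [size_le1]. Hence $\sigma^{-1}\sum_n
    nS_n$ at [rcons s x] becomes $\sigma^{-1}\sigma=1$ at [s]. *)
Lemma psum_Psi_coef s : all (ltn 0) s -> psum Psi_coef s = (size s == 1)%:R.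
Proof.
move=> ps; rewrite (eq_psum _ Psi_coefE) psum_dconv.
case/lastP: s ps => [|s x] ps.
  by rewrite dconv_nil {2}/psum big_seq1 !mulr0.
rewrite dconv_rcons.
rewrite {2}/psum big_seq1 !mulr0 add0r size_rcons eqSS size_eq0.
transitivity (dconv (psum sgn_size) (psum size_le1) s).
  apply: eq_dconv => // k; rewrite psum_size_le1 /= psum_size1_val //.
  move: ps; rewrite !all_rcons => /andP[-> /allP ps] /=.
  by apply/allP => y /mem_drop /ps.
by rewrite -psum_dconv (eq_psum _ dconv_sgn_size) psum_nilp; case: s {ps}.
Qed.

(** Since $\psi$ deconcatenates, each factor must match exactly one part, removed from the end. *)
Lemma psum_cfun_Psi_coef s rb : all (ltn 0) s ->
  psum (convprod Psi_coef rb) s = (s == rev rb)%:R.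
Proof.
elim: rb s => [|n rb IH] s ps /=; first by rewrite psum_nilp; case: s {ps}.
rewrite psum_dconv.
transitivity (dconv (fun t => (t == rev rb)%:R) (deg n (fun t => (size t == 1)%:R : K)) s).
  apply: eq_dconv => k.
    by apply: IH; apply/allP => y /mem_take; apply/allP.
  rewrite psum_deg /deg psum_Psi_coef //; apply/allP => y /mem_drop; exact/allP.
rewrite rev_cons; case/lastP: s {ps} => [|s x].
  by rewrite dconv_nil /deg /= if_same mulr0; case: (rev rb).
rewrite dconv_rcons {1}/deg /= if_same mulr0 add0r dconv_delta_r /=; last first.
  by move=> t t0; rewrite /deg /= size_rcons eqSS size_eq0 (negPf t0) if_same.
rewrite /deg /= addn0 eqseq_rcons; case: eqP => _; by case: eqP; rewrite ?mulr1 ?mulr0.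
Qed.

End PowerSums.

(** * Hooks, [MaxOne] and the coefficient functionals *)

Section Hooks.
Variable K : numFieldType.

(* The values of [Psi_coef] on the basis [L]: [(-1)^k] on [(1^k, n-k)]. *)
Fixpoint Psi_coef_bits (w : bitseq) : K :=
  if w is b :: w' then if b then - Psi_coef_bits w' else (all negb w')%:R else 1.

(** The hook $(n-k,1^k)$ has the word of $n-1-k$ letters [false] followed by $k$ letters [true]. *)
Fixpoint hook_bits (w : bitseq) : K :=
  if w is b :: w' then
    if b then (-1) ^+ size w * (all id w')%:R else hook_bits w'
  else 1.

(** Negating a hook word gives $n-1-k$ letters [true] followed by letters [false], of sign
    $(-1)^{n-1-k}$. *)
Lemma Psi_coef_bits_negb w :
  Psi_coef_bits (map negb w) = (-1) ^+ size w * hook_bits w.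
Proof.
elim: w => [|[] w IH] /=; first by rewrite mulr1.
  rewrite mulrA -expr2 sqrr_sign mul1r all_map; congr (_%:R).
  by congr nat_of_bool; apply: eq_all => b /=; rewrite negbK.
by rewrite IH exprS mulN1r mulNr.
Qed.

Lemma Psi_coef_true w : Psi_coef K (of_bits (true :: w)) = - Psi_coef K (of_bits w).
Proof.
rewrite /=; have := of_bits_neq0 w; case: (of_bits w) => //= x s _.
by rewrite exprS mulN1r mulNr.
Qed.

(** Incrementing the first part affects the last part only if they coincide. *)
Lemma Psi_coef_false w :
  Psi_coef K (of_bits (false :: w)) = Psi_coef K (of_bits w) + (all negb w)%:R.
Proof.
have -> : all negb w = (size (of_bits w) == 1)%N.
  elim: w => [|[] w IH] //=; have := of_bits_neq0 w; case: (of_bits w) IH => //.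
rewrite /=; have := of_bits_neq0 w; case: (of_bits w) => //= x [|y s] _ /=.
  by rewrite !mul1r -natr1.
by rewrite addr0.
Qed.

Lemma big_dominating_false w :
  \sum_(v <- dominating w) (all negb v)%:R = (all negb w)%:R :> K.
Proof.
elim: w => [|[] w IH]; first by rewrite big_seq1.
  by rewrite /= cats0 big_map big1.
by rewrite /= big_cat !big_map /= IH big1 // add0r.
Qed.

(** For a leading [false], the words [true :: v] and [false :: v] pair up, and their values cancel
    up to a 1 when [v] has no [true]. *)
Lemma Lsum_Psi_coef w : Lsum (Psi_coef K) w = Psi_coef_bits w.
Proof.
elim: w => [|[] w IH]; first by rewrite /Lsum big_seq1 /= mulr1.
  rewrite [RHS]/= -IH /Lsum [dominating _]/= cats0 big_map -sumrN.
  by apply: eq_bigr => v _; rewrite Psi_coef_true.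
rewrite [RHS]/= -big_dominating_false /Lsum [dominating _]/= big_cat !big_map.
transitivity (\sum_(v <- dominating w)
  (Psi_coef K (of_bits (true :: v)) + Psi_coef K (of_bits (false :: v)))).
  by rewrite big_split.
by apply: eq_bigr => v _; rewrite Psi_coef_true Psi_coef_false addKr.
Qed.

Lemma hook_signE (a : composition) : parts a != [::] ->
  hook_sign K a = if all (pred1 1%N) (behead a) then (-1) ^+ (size a).-1 else 0.
Proof.
rewrite /hook_sign; case: a => -[//|x s] /= /andP[x0 ps] _.
case: pickP => [k /eqP[ex es]|no].
  by move: (nat_of_ord k) es {ex} => i ->; rewrite all_nseq /= orbT size_nseq.
case: ifPn => // /all_pred1P es.
have ss : sumn s = size s by rewrite {1}es sumn_nseq mul1n.
have sz : (size s < x + sumn s)%N by rewrite ss -[X in (X < _)%N]add0n ltn_add2r.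
by have := no (Ordinal sz); rewrite /= ss addnK -es eqxx.
Qed.

Lemma hook_sign_bits (a : composition) w : parts a = of_bits w ->
  hook_sign K a = hook_bits w.
Proof.
move=> aw; rewrite hook_signE aw ?of_bits_neq0 // {aw}.
have ones v : all (pred1 1%N) (of_bits v) = all id v.
  elim: v => [|[] v IH] //=; have := of_bits_neq0 v; have := of_bits_gt0 v.
  by case: (of_bits v) => //= -[].
elim: w => [|[] w IH] //=; last by rewrite -IH; have := of_bits_neq0 w; case: (of_bits w).
rewrite ones; case: ifPn => [aw|_]; last by rewrite mulr0.
rewrite mulr1; congr (_ ^+ _).
elim: w aw {IH} => [|[] w IH] //= aw; by rewrite IH.
Qed.

Lemma Lsum_MaxOne w :
  Lsum (Psi_coef K) (map negb w) =
  (-1) ^+ size w * Lsum (fun s => MaxOne K (Ms K s)) w.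
Proof.
pose a := Composition (of_bits_gt0 w).
rewrite Lsum_Psi_coef Psi_coef_bits_negb -(@hook_sign_bits a) //; congr (_ * _).
by rewrite -(@L_bits _ _ a) // /MaxOne LlinE.
Qed.

Definition coef_psi (b : composition) : {linear QSym K -> K^o} :=
  Mlin (fun a : composition => convprod (Psi_coef K) (rev b) a : K^o).

Lemma Mlin_Ms (phi : seq nat -> K) (s : seq nat) : all (ltn 0) s ->
  Mlin (fun a : composition => phi a : K^o) (Ms K s) = phi s.
Proof. by move=> ps; rewrite -[s]/(parts (Composition ps)) Ms_parts MlinE. Qed.

Lemma coef_psi_psi b a : coef_psi b (psi K a) = (a == b)%:R.
Proof.
rewrite psi_cuts -[(a == b)]/(parts a == parts b) -[parts b]revK.
rewrite -psum_cfun_Psi_coef ?comp_gt0 // /psum.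
rewrite big_seq [RHS]big_seq; apply: eq_bigr => ss; rewrite mem_cuts => /andP[/eqP fa ss0].
congr (_ * _); rewrite /coef_psi Mlin_Ms //.
apply/allP => _ /mapP[t tss ->]; have := allP ss0 t tss.
have : all (ltn 0) t.
  by apply/allP => x xt; apply: (allP (comp_gt0 a)); rewrite -fa; apply/flattenP; exists t.
by case: t {tss} => //= x t /andP[x0 _] _; rewrite addn_gt0 x0.
Qed.

Lemma Lsum_Mlin (phi : seq nat -> K) w :
  Lsum (fun s => Mlin (fun a : composition => phi a : K^o) (Ms K s)) w = Lsum phi w.
Proof. by apply: eq_bigr => v _; rewrite Mlin_Ms ?of_bits_gt0. Qed.

Lemma coef_psi_omegarho (b : composition) f :
  coef_psi b (omegarho K f) =
  (-1) ^+ (sumn b - size b) * MaxOne_tensor K (Delta_comp b f).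
Proof.
rewrite MaxOne_Delta; set G := Mlin _.
have : (coef_psi b \o omegarho K)%FUN =1 ((-1) ^+ (sumn b - size b) \*: G); last exact.
apply: Llin_uniq => a /=; rewrite /omegarho LlinE.
have prb : all (ltn 0) (rev b) by rewrite all_rev comp_gt0.
(* The empty composition has no descent word; there both sides are 1 for empty [b] and 0
   otherwise. *)
have [a0|a0] := eqVneq (parts a) [::].
  have La (F : {linear QSym K -> K^o}) (a' : composition) : parts a' = [::] ->
      F (L K a') = F (Ms K [::]).
    move=> e; have -> : a' = Composition (isT : all (ltn 0) [::]) by exact: val_inj.
    rewrite /L linear_sum; under eq_bigr do rewrite -Ms_parts.
    rewrite (big_comps (V := K^o) _ (fun s => refines s [::]) (fun s => F (Ms K s))).
    by rewrite big_mkcond big_seq1.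
  rewrite !La // /=; last by rewrite /compl_seq a0.
  rewrite /coef_psi /G !Mlin_Ms // !convprod_nil // /nilp size_rev.
  by case: (parts b) => [|x s] /=; rewrite ?scale1r ?scaler0.
have [w aw] := of_bits_surj (comp_gt0 a) a0.
rewrite (L_bits _ aw) (@L_bits _ _ _ (map negb w)); last by rewrite /= aw compl_of_bits.
rewrite !Lsum_Mlin (Lsum_convprod _ (@Lsum_MaxOne)) //.
by rewrite sumn_rev size_rev.
Qed.

End Hooks.

Theorem theorem3p10 (R : realType) (alpha : composition)
    (c : {fsfun composition -> R[i] with 0}) :
  omegarho R[i] (psi R[i] alpha) =
    \sum_(beta <- finsupp c) c beta *: psi R[i] beta ->
  forall beta : composition,
    c beta = (-1) ^+ (sumn beta - size beta) *
             MaxOne_tensor R[i] (Delta_comp beta (psi R[i] alpha)).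
Proof.
(* The right side is the functional dual to $\psi_\beta$ applied to the given expansion. *)
move=> E beta; rewrite -coef_psi_omegarho E linear_sum.
under eq_bigr do rewrite linearZ /= coef_psi_psi.
(* Outside its support [c] has the default value 0, and no term of the sum is indexed by [beta]. *)
have [cb|cb] := finsuppP c beta.
  rewrite big_seq big1 // => b bc; case: eqP => [e|_]; last by rewrite scaler0.
  by rewrite e (negPf cb) in bc.
rewrite (bigD1_seq beta) ?fset_uniq //= eqxx [_ *: 1]mulr1 big1 ?addr0 // => b /negPf ->.
by rewrite scaler0.
Qed.
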